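(* Let $M$ be a de Morgan algebra, $D$ a bounded distributive lattice, and $A$ a sublattice of $\mathrm{Con}(M)\times\mathrm{Con}(D)$. Then $A$ is representable if and only if there exists a lattice $(0,1)$-homomorphism $\varphi: M\to D$ such that for every $\theta_1\in\mathrm{Con}(M)$ and every $\theta_2\in\mathrm{Con}(D)$, $$(\theta_1,\theta_2)\in A\iff \mathrm{Con}(\varphi)(\theta_1)\subseteq\theta_2.$$
   Context: An MS-algebra is an algebra $(L;\vee,\wedge,{}^{\circ},0,1)$ where $(L;\vee,\wedge,0,1)$ is a bounded distributive lattice and ${}^{\circ}$ is a unary operation with $x\le x^{\circ\circ}$, $(x\wedge y)^{\circ}=x^{\circ}\vee y^{\circ}$ and $1^{\circ}=0$; a de Morgan algebra is an MS-algebra with $x=x^{\circ\circ}$. For an MS-algebra $L$: $L^{\circ\circ}=\{x\mid x=x^{\circ\circ}\}$ (a de Morgan subalgebra), $D(L)=\{x\mid x^{\circ}=0\}$ (a filter). $L$ is principal if there is $d_L$ with $D(L)=\{x\mid x\ge d_L\}$ and $x=x^{\circ\circ}\wedge(x\vee d_L)$ for all $x$; then $D(L)$ is a bounded distributive lattice with bounds $d_L,1$. An MS-congruence pair of a principal MS-algebra $L$ is $(\theta_1,\theta_2)\in\mathrm{Con}(L^{\circ\circ})\times\mathrm{Con}(D(L))$ (de Morgan algebra congruences, resp. lattice congruences) such that $(a,b)\in\theta_1$ implies $(a\vee d_L,b\vee d_L)\in\theta_2$; $A(L)$ is the set of these. For a homomorphism $\tau:X\to Y$ and $\theta\in\mathrm{Con}(X)$,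 $\mathrm{Con}(\tau)(\theta)$ is the congruence of $Y$ generated by all pairs $(\tau(x),\tau(y))$, $(x,y)\in\theta$. A subset $A\subseteq\mathrm{Con}(M)\times\mathrm{Con}(D)$ is representable if there exist a principal MS-algebra $L$, a de Morgan algebra isomorphism $\tau_1:M\to L^{\circ\circ}$ and a bounded lattice isomorphism $\tau_2:D\to D(L)$ such that $A=\{(\theta_1,\theta_2)\mid(\mathrm{Con}(\tau_1)(\theta_1),\mathrm{Con}(\tau_2)(\theta_2))\in A(L)\}$. *)

(* Defs.v *)
From HB Require Import structures.
From mathcomp Require Import all_boot all_order.
From mathcomp Require Import boolp classical_sets.

Set Implicit Arguments.
Unset Strict Implicit.
Unset Printing Implicit Defensive.

Import Order.TTheory.
Local Open Scope order_scope.

(* [circ x] is x°. *)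

HB.mixin Record isMSAlgebra (d : Order.disp_t) T
    of Order.TBDistrLattice d T := {
  circ : T -> T;
  le_circ2 : forall x : T, x <= circ (circ x);
  circI : forall x y : T, circ (x `&` y) = circ x `|` circ y;
  circ1 : circ \top = \bot;
}.

#[short(type="msAlgType")]
HB.structure Definition MSAlgebra d :=
  { T of isMSAlgebra d T & Order.TBDistrLattice d T }.

HB.mixin Record MSAlgebra_isDeMorgan d T of MSAlgebra d T := {
  circK : forall x : T, x = circ (circ x);
}.

#[short(type="deMorganType")]
HB.structure Definition DeMorgan d :=
  { T of MSAlgebra_isDeMorgan d T & MSAlgebra d T }.

(* [d_L], being the least element of D(L) = {x | x° = 0}, is determined by L,
   so it may be carried as part of the structure. *)
HB.mixin Record MSAlgebra_isPrincipal d T of MSAlgebra d T := {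
  d_L : T;
  densePE : forall x : T, circ x = \bot <-> d_L <= x;
  circ2I_joind : forall x : T, x = circ (circ x) `&` (x `|` d_L);
}.

#[short(type="principalMSType")]
HB.structure Definition PrincipalMS d :=
  { T of MSAlgebra_isPrincipal d T & MSAlgebra d T }.

Section MSTheory.
Context {d : Order.disp_t} {L : msAlgType d}.
Implicit Types x y : L.

Lemma circ_anti x y : x <= y -> circ y <= circ x.
Proof. by move/meet_idPl <-; rewrite circI leUr. Qed.

Lemma circ3 x : circ (circ (circ x)) = circ x.
Proof. by apply: le_anti; rewrite le_circ2 circ_anti ?le_circ2. Qed.

Lemma circ0 : circ \bot = \top :> L.
Proof. by apply: le_anti; rewrite lex1 -circ1 le_circ2. Qed.

Lemma circU x y : circ (x `|` y) = circ x `&` circ y.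
Proof.
apply: le_anti; rewrite lexI !circ_anti ?leUl ?leUr //=.
apply: le_trans (le_circ2 _) _; rewrite circI circ_anti //.
by rewrite leU2 // le_circ2.
Qed.

End MSTheory.

Section Skeleton.
Context (d : Order.disp_t) (L : msAlgType d).

Definition skeleton_pred : pred L := fun x => x == circ (circ x).

(* L°° = {x | x = x°°} *)
Record skeleton := Skeleton { skeleton_val : L; _ : skeleton_pred skeleton_val }.

HB.instance Definition _ := [isSub for skeleton_val].
HB.instance Definition _ := [Choice of skeleton by <:].

Fact skeleton_meet : meet_closed skeleton_pred.
Proof.
by move=> x y /eqP xE /eqP yE; apply/eqP; rewrite circI circU -xE -yE.
Qed.

Fact skeleton_join : join_closed skeleton_pred.
Proof.
by move=> x y /eqP xE /eqP yE; apply/eqP; rewrite circU circI -xE -yE.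
Qed.

Fact skeleton_bot : \bot \in skeleton_pred.
Proof. by apply/eqP; rewrite circ0 circ1. Qed.

Fact skeleton_top : \top \in skeleton_pred.
Proof. by apply/eqP; rewrite circ1 circ0. Qed.

HB.instance Definition _ :=
  Order.SubChoice_isTBSubLattice.Build d L skeleton_pred d skeleton
    skeleton_meet skeleton_join skeleton_bot skeleton_top.

Fact skeleton_meetUl : left_distributive (@Order.meet d skeleton) Order.join.
Proof.
by move=> x y z; apply: val_inj; exact: (meetUl (val x) (val y) (val z)).
Qed.

HB.instance Definition _ :=
  Order.Lattice_Meet_isDistrLattice.Build d skeleton skeleton_meetUl.

Fact skeleton_circ_subproof (x : skeleton) : skeleton_pred (circ (val x)).
Proof. by rewrite /skeleton_pred circ3. Qed.

Definition skeleton_circ (x : skeleton) : skeleton :=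
  Skeleton (skeleton_circ_subproof x).

Fact skeleton_le_circ2 (x : skeleton) : x <= skeleton_circ (skeleton_circ x).
Proof. exact: (le_circ2 (val x)). Qed.

Fact skeleton_circI (x y : skeleton) :
  skeleton_circ (x `&` y) = skeleton_circ x `|` skeleton_circ y.
Proof. by apply: val_inj; exact: (circI (val x) (val y)). Qed.

Fact skeleton_circ1 : skeleton_circ \top = \bot.
Proof. by apply: val_inj; exact: (@circ1 d L). Qed.

HB.instance Definition _ := isMSAlgebra.Build d skeleton
  skeleton_le_circ2 skeleton_circI skeleton_circ1.

Fact skeleton_circK (x : skeleton) : x = circ (circ x).
Proof. by apply: val_inj; exact: (eqP (valP x)). Qed.

HB.instance Definition _ := MSAlgebra_isDeMorgan.Build d skeleton skeleton_circK.

End Skeleton.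

Section Dense.
Context (d : Order.disp_t) (L : msAlgType d).

Definition dense_pred : pred L := fun x => circ x == \bot.

(* D(L) = {x | x° = 0} *)
Record dense := Dense { dense_val : L; _ : dense_pred dense_val }.

HB.instance Definition _ := [isSub for dense_val].
HB.instance Definition _ := [Choice of dense by <:].

Fact dense_meet : meet_closed dense_pred.
Proof.
by move=> x y /eqP xE /eqP yE; apply/eqP; rewrite circI xE yE joinxx.
Qed.

Fact dense_join : join_closed dense_pred.
Proof. by move=> x y /eqP xE /eqP yE; apply/eqP; rewrite circU xE yE meetxx. Qed.

Fact dense_top : \top \in dense_pred.
Proof. by apply/eqP; rewrite circ1. Qed.

HB.instance Definition _ :=
  Order.SubChoice_isTSubLattice.Build d L dense_pred d dense
    dense_meet dense_join dense_top.

Fact dense_meetUl : left_distributive (@Order.meet d dense) Order.join.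
Proof.
by move=> x y z; apply: val_inj; exact: (meetUl (val x) (val y) (val z)).
Qed.

HB.instance Definition _ :=
  Order.Lattice_Meet_isDistrLattice.Build d dense dense_meetUl.

End Dense.

Section PrincipalDense.
Context (d : Order.disp_t) (L : principalMSType d).

Fact joind_subproof (x : L) : dense_pred (x `|` d_L).
Proof. by apply/eqP/densePE; rewrite leUr. Qed.

(* x |-> x \/ d_L, with values in D(L) *)
Definition joind (x : L) : dense L := Dense (joind_subproof x).

Fact dense_bot_subproof : dense_pred (d_L : L).
Proof. exact/eqP/densePE. Qed.

Fact dense_le0x (x : dense L) : Dense dense_bot_subproof <= x.
Proof. by apply/densePE; exact: (eqP (valP x)). Qed.

HB.instance Definition _ := Order.hasBottom.Build d (dense L) dense_le0x.

End PrincipalDense.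

(* Congruences of an algebra on T whose unary (resp. binary) operations are the
   members of U (resp. B); nullary operations impose no condition. *)
Section Congruence.
Context {T : Type} {U : set (T -> T)} {B : set (T -> T -> T)}.

Record con := Con {
  con_rel :> T -> T -> Prop;
  con_refl : forall x, con_rel x x;
  con_sym : forall x y, con_rel x y -> con_rel y x;
  con_trans : forall x y z, con_rel x y -> con_rel y z -> con_rel x z;
  con_unary : forall f, U f ->
    forall x y, con_rel x y -> con_rel (f x) (f y);
  con_binary : forall f, B f ->
    forall x x' y y', con_rel x x' -> con_rel y y' -> con_rel (f x y) (f x' y');
}.

Lemma con_ext (s t : con) : (forall x y, s x y <-> t x y) -> s = t.
Proof.
case: s t => [r r1 r2 r3 r4 r5] [q q1 q2 q3 q4 q5] /= rq.
have E : r = q by apply/funext => x; apply/funext => y; apply/propext.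
by case: q / E q1 q2 q3 q4 q5 {rq} => *; f_equal; apply: Prop_irrelevance.
Qed.

Local Obligation Tactic := idtac.

Program Definition con_gen (P : T -> T -> Prop) : con :=
  @Con (fun x y => forall t : con, (forall a b, P a b -> t a b) -> t x y)
    _ _ _ _ _.
Next Obligation. by move=> P x t _; exact: con_refl. Qed.
Next Obligation. by move=> P x y xy t Pt; apply/con_sym/xy. Qed.
Next Obligation.
by move=> P x y z xy yz t Pt; exact: con_trans (xy t Pt) (yz t Pt).
Qed.
Next Obligation.
by move=> P f Uf x y xy t Pt; exact: con_unary (xy t Pt).
Qed.
Next Obligation.
by move=> P f Bf x x' y y' xx' yy' t Pt;
  exact: con_binary (xx' t Pt) (yy' t Pt).
Qed.

Program Definition con_meet (s t : con) : con :=
  @Con (fun x y => s x y /\ t x y) _ _ _ _ _.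
Next Obligation. by move=> s t x; split; exact: con_refl. Qed.
Next Obligation. by move=> s t x y [? ?]; split; exact: con_sym. Qed.
Next Obligation.
by move=> s t x y z [s1 t1] [s2 t2]; split;
  [exact: con_trans s1 s2 | exact: con_trans t1 t2].
Qed.
Next Obligation. by move=> s t f Uf x y [? ?]; split; exact: con_unary. Qed.
Next Obligation.
by move=> s t f Bf x x' y y' [? ?] [? ?]; split; exact: con_binary.
Qed.

Definition con_join (s t : con) : con := con_gen (fun x y => s x y \/ t x y).

Definition con_le (s t : con) : bool := `[< forall x y, s x y -> t x y >].

HB.instance Definition _ := gen_eqMixin con.
HB.instance Definition _ := gen_choiceMixin con.

Fact con_display : Order.disp_t. Proof. exact: (Order.Disp tt tt). Qed.

Fact con_le_refl : reflexive con_le.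
Proof. by move=> s; apply/asboolP. Qed.

Fact con_le_anti : antisymmetric con_le.
Proof.
move=> s t /andP[/asboolP st /asboolP ts]; apply: con_ext => x y.
by split; [exact: st | exact: ts].
Qed.

Fact con_le_trans : transitive con_le.
Proof.
move=> t s u /asboolP st /asboolP tu; apply/asboolP => x y xy.
exact/tu/st.
Qed.

HB.instance Definition _ := Order.Le_isPOrder.Build con_display con
  con_le_refl con_le_anti con_le_trans.

Fact con_lexI (s t u : con) : (s <= con_meet t u) = (s <= t) && (s <= u).
Proof.
apply/asboolP/andP => [H|[/asboolP H1 /asboolP H2] x y xy].
  by split; apply/asboolP => x y /H[].
by split; [exact: H1 | exact: H2].
Qed.

Fact con_leUx (s t u : con) : (con_join s t <= u) = (s <= u) && (t <= u).
Proof.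
apply/asboolP/andP => [H|[/asboolP H1 /asboolP H2] x y].
  by split; apply/asboolP => x y xy; apply: H => v; apply; [left|right].
by apply=> a b [/H1|/H2].
Qed.

HB.instance Definition _ :=
  Order.POrder_MeetJoin_isLattice.Build con_display con con_lexI con_leUx.

End Congruence.
Arguments con {T} U B.

(* Con(tau): the congruence of the codomain generated by the tau-image of
   theta. *)
Definition con_map {T1 T2 : Type} {U1 : set (T1 -> T1)} {U2 : set (T2 -> T2)}
    {B1 : set (T1 -> T1 -> T1)} {B2 : set (T2 -> T2 -> T2)}
    (tau : T1 -> T2) (theta : con U1 B1) : con U2 B2 :=
  con_gen (fun u v => exists x y, [/\ theta x y, u = tau x & v = tau y]).

Notation latcon X := (con (T := X) set0 [set Order.meet; Order.join]%classic).
Notation mscon X :=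
  (con (T := X) [set circ]%classic [set Order.meet; Order.join]%classic).

(* The library's {tblmorphism _ -> _} only preserves the bounds. *)
Definition lattice01_hom {d d'} {X : tbLatticeType d} {Y : tbLatticeType d'}
    (f : X -> Y) : Prop :=
  [/\ Order.meet_morphism f, Order.join_morphism f, f \bot = \bot
    & f \top = \top].

Definition ms_hom {d d'} {X : msAlgType d} {Y : msAlgType d'}
    (f : X -> Y) : Prop :=
  lattice01_hom f /\ {morph f : x / circ x}.

(* The empty set is admitted. *)
Definition sublattice {d} {X : latticeType d} (S : set X) : Prop :=
  meet_closed [in S] /\ join_closed [in S].

(* A(L), the MS-congruence pairs of L *)
Definition ms_con_pairs {d} (L : principalMSType d) :
    set (mscon (skeleton L) * latcon (dense L)) :=
  [set t : mscon (skeleton L) * latcon (dense L) | forall a b : skeleton L,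
     t.1 a b -> t.2 (joind (val a)) (joind (val b))]%classic.

Definition representable {dM dD : Order.disp_t} (M : deMorganType dM)
    (D : tbDistrLatticeType dD) (A : set (mscon M * latcon D)) : Prop :=
  exists (d : Order.disp_t) (L : principalMSType d)
    (tau1 : M -> skeleton L) (tau2 : D -> dense L),
    [/\ ms_hom tau1 /\ bijective tau1, lattice01_hom tau2 /\ bijective tau2
      & A = [set t | ms_con_pairs (con_map tau1 t.1, con_map tau2 t.2)]%classic].

(* Main.v *)
(* An MS-congruence pair is a condition on the map x |-> x \/ d_L from L°° to
   D(L) alone: carried along tau1 and tau2, this map is a (0,1)-homomorphism
   phi : M -> D, and (theta1, theta2) is a pair iff phi sends theta1 into
   theta2. Conversely every phi arises in this way from the lattice of the
   (x, y) in M x D with y <= phi x, where (x, y)° = (x°, phi x°): its skeleton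
   is the graph of phi, and its dense elements are the (1, y). *)
From HB Require Import structures.
Require Import Defs.
From mathcomp Require Import all_boot all_order.
From mathcomp Require Import boolp classical_sets.

Import Order.TTheory.
Local Open Scope order_scope.

(** * Congruences transported along maps *)

Section ConMap.
Context {T1 T2 : Type} {U1 : set (T1 -> T1)} {U2 : set (T2 -> T2)}
  {B1 : set (T1 -> T1 -> T1)} {B2 : set (T2 -> T2 -> T2)}.
Implicit Types (s : con U1 B1) (t : con U2 B2) (f : T1 -> T2).

(** [con_map f s] is the least congruence containing its generating pairs, so only those pairs have
    to be tested. *)
Lemma con_map_le f s t :
  con_map f s <= t <-> (forall x y, s x y -> t (f x) (f y)).
Proof.
split=> [/asboolP le_fs_t x y sxy|fs_t].
  by apply: le_fs_t => u; apply; exists x, y.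
by apply/asboolP => u v; apply=> _ _ [x [y [sxy -> ->]]]; exact: fs_t.
Qed.

Local Obligation Tactic := idtac.

Program Definition con_preim f
    (fU : forall u, U1 u -> exists2 v, U2 v & forall x, f (u x) = v (f x))
    (fB : forall b, B1 b ->
      exists2 c, B2 c & forall x y, f (b x y) = c (f x) (f y))
    t : con U1 B1 :=
  @Con T1 U1 B1 (fun x y => t (f x) (f y)) _ _ _ _ _.
Next Obligation. by move=> f fU fB t x; exact: con_refl. Qed.
Next Obligation. by move=> f fU fB t x y; exact: con_sym. Qed.
Next Obligation. by move=> f fU fB t x y z; exact: con_trans. Qed.
Next Obligation.
by move=> f fU fB t u /fU[v Uv uv] x y; rewrite !uv; exact: con_unary.
Qed.
Next Obligation.
by move=> f fU fB t b /fB[c Bc bc] x x' y y'; rewrite !bc; exact: con_binary.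
Qed.

End ConMap.

(** Generation adds no pairs along an isomorphism: pulling [s] back along the inverse of [f] gives a
    congruence that contains all generators, hence all of [con_map f s]. *)
Lemma con_map_bij {T1 T2 : Type} {U1 : set (T1 -> T1)} {U2 : set (T2 -> T2)}
    {B1 : set (T1 -> T1 -> T1)} {B2 : set (T2 -> T2 -> T2)}
    (f : T1 -> T2) (s : con U1 B1) :
    bijective f ->
    (forall u, U2 u -> exists2 v, U1 v & {morph f : x / v x >-> u x}) ->
    (forall b, B2 b -> exists2 c, B1 c & {morph f : x y / c x y >-> b x y}) ->
  forall x y, (con_map f s : con U2 B2) (f x) (f y) <-> s x y.
Proof.
move=> [g fK gK] fU fB x y; split=> [sfxy|sxy]; last first.
  by move=> t; apply; exists x, y.
have gU u : U2 u -> exists2 v, U1 v & forall x, g (u x) = v (g x).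
  by case/fU=> v Uv fv; exists v => // z; rewrite -{1}(gK z) -fv fK.
have gB b : B2 b -> exists2 c, B1 c & forall x y, g (b x y) = c (g x) (g y).
  by case/fB=> c Bc fc; exists c => // z w; rewrite -{1}(gK z) -{1}(gK w) -fc fK.
have := sfxy (con_preim g gU gB s); rewrite /= !fK; apply.
by move=> _ _ [a [b [sab -> ->]]]; rewrite !fK.
Qed.

Lemma con_map_ms_iso {d d'} {X : msAlgType d} {Y : msAlgType d'} (f : X -> Y)
    (s : mscon X) : ms_hom f -> bijective f ->
  forall x y, (con_map f s : mscon Y) (f x) (f y) <-> s x y.
Proof.
move=> [[fI fU _ _] fC] f_bij; apply: con_map_bij => // [_ ->|_ [->|->]].
- by exists circ.
- by exists Order.meet; [left|].
- by exists Order.join; [right|].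
Qed.

Lemma con_map_lat_iso {d d'} {X : tbLatticeType d} {Y : tbLatticeType d'}
    (f : X -> Y) (s : latcon X) : lattice01_hom f -> bijective f ->
  forall x y, (con_map f s : latcon Y) (f x) (f y) <-> s x y.
Proof.
move=> [fI fU _ _] f_bij; apply: con_map_bij => // _ [->|->].
- by exists Order.meet; [left|].
- by exists Order.join; [right|].
Qed.

(** Serves both directions of the theorem. As [tau1] and [tau2] preserve and reflect the
    congruences, the pair condition at [tau1 x], [tau1 y] becomes [s x y -> t (phi x) (phi y)]. *)
Lemma ms_con_pairs_con_map {d dM dD : Order.disp_t} {L : principalMSType d}
    {M : deMorganType dM} {D : tbDistrLatticeType dD}
    {tau1 : M -> skeleton L} {tau2 : D -> dense L} {phi : M -> D}
    (s : mscon M) (t : latcon D) :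
    ms_hom tau1 -> bijective tau1 -> lattice01_hom tau2 -> bijective tau2 ->
    (forall a, tau2 (phi a) = joind (val (tau1 a))) ->
  ms_con_pairs (con_map tau1 s, con_map tau2 t) <-> con_map phi s <= t.
Proof.
move=> h1 b1 h2 b2 phiE; rewrite con_map_le; split=> [st x y sxy|st a b].
  apply/(con_map_lat_iso _ _ h2 b2); rewrite !phiE.
  by apply: st; apply/(con_map_ms_iso _ _ h1 b1).
have [g _ gK] := b1; rewrite -(gK a) -(gK b) /=.
move/(con_map_ms_iso _ _ h1 b1)/st => txy.
by rewrite -!phiE; apply/(con_map_lat_iso _ _ h2 b2).
Qed.

(** * Lattice (0,1)-homomorphisms *)

Lemma joind_hom {d} (L : principalMSType d) :
  lattice01_hom (fun a : skeleton L => joind (val a)).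
Proof.
split.
- by move=> a b; apply: val_inj; exact: (joinIl (val a) (val b) d_L).
(* Doubling [d_L] provides one copy for each of [a] and [b]. *)
- move=> a b; apply: val_inj; rewrite /= -{1}(joinxx (d_L : L)).
  exact: joinACA.
- by apply: val_inj; rewrite /= join0x.
- by apply: val_inj; rewrite /= join1x.
Qed.

Lemma lattice01_hom_comp {d1 d2 d3} {X : tbLatticeType d1}
    {Y : tbLatticeType d2} {Z : tbLatticeType d3} {f : Y -> Z} {g : X -> Y} :
  lattice01_hom f -> lattice01_hom g -> lattice01_hom (f \o g).
Proof.
move=> [fI fU f0 f1] [gI gU g0 g1]; split=> [x y|x y||] /=.
- by rewrite gI fI.
- by rewrite gU fU.
- by rewrite g0 f0.
- by rewrite g1 f1.
Qed.

Lemma lattice01_hom_inv {d1 d2} {X : tbLatticeType d1} {Y : tbLatticeType d2}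
    {f : X -> Y} {g : Y -> X} :
  cancel f g -> cancel g f -> lattice01_hom f -> lattice01_hom g.
Proof.
move=> fK gK [fI fU f0 f1]; split=> [x y|x y||]; apply: (can_inj fK).
- by rewrite fI !gK.
- by rewrite fU !gK.
- by rewrite gK f0.
- by rewrite gK f1.
Qed.

(** * The subgraph of [phi] as a principal MS-algebra *)

Section Subgraph.
Context {dM dD : Order.disp_t} {M : deMorganType dM}
  {D : tbDistrLatticeType dD} (phi : M -> D) (phi_hom : lattice01_hom phi).

Definition subgraph_pred : pred (M *p D) := fun p => p.2 <= phi p.1.

(* The proof [phi_hom] is a parameter of the type so that the algebraic
   structures below can be inferred. *)
Record subgraph (h : lattice01_hom phi) :=
  Subgraph { subgraph_val : M *p D; _ : subgraph_pred subgraph_val }.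

Local Notation L := (subgraph phi_hom).

HB.instance Definition _ := [isSub of L for @subgraph_val phi_hom].
HB.instance Definition _ := [Choice of L by <:].

Fact subgraph_meet : meet_closed subgraph_pred.
Proof.
have [phiI _ _ _] := phi_hom.
by move=> [x y] [x' y']; rewrite !unfold_in /= phiI; exact: leI2.
Qed.

Fact subgraph_join : join_closed subgraph_pred.
Proof.
have [_ phiU _ _] := phi_hom.
by move=> [x y] [x' y']; rewrite !unfold_in /= phiU; exact: leU2.
Qed.

Fact subgraph_bot : \bot \in subgraph_pred.
Proof. exact: le0x. Qed.

Fact subgraph_top : \top \in subgraph_pred.
Proof. by have [_ _ _ phi1] := phi_hom; rewrite unfold_in /= phi1. Qed.

HB.instance Definition _ :=
  Order.SubChoice_isTBSubLattice.Build _ (M *p D) subgraph_pred dM L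
    subgraph_meet subgraph_join subgraph_bot subgraph_top.

Fact subgraph_meetUl : left_distributive (@Order.meet dM L) Order.join.
Proof.
by move=> x y z; apply: val_inj; exact: (meetUl (val x) (val y) (val z)).
Qed.

HB.instance Definition _ :=
  Order.Lattice_Meet_isDistrLattice.Build dM L subgraph_meetUl.

Definition graph (a : M) : L :=
  @Subgraph phi_hom (a, phi a) (lexx (phi a)).

Definition subgraph_circ (p : L) : L := graph (circ (val p).1).

(** For p = (x, y), p°° = (x, phi x) because x°° = x in [M]; the second coordinate is then the
    membership condition y <= phi x. *)
Fact subgraph_le_circ2 (p : L) : p <= subgraph_circ (subgraph_circ p).
Proof. by case: p => -[x y] yx; apply/andP; rewrite /= -circK. Qed.

(** Since [subgraph_circ] factors through [graph], the homomorphism laws of [graph] carry the laws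
    of ° over from [M]. *)
Lemma graphI : {morph graph : a b / a `&` b}.
Proof.
by have [phiI _ _ _] := phi_hom; move=> a b; apply: val_inj; rewrite /= phiI.
Qed.

Lemma graphU : {morph graph : a b / a `|` b}.
Proof.
by have [_ phiU _ _] := phi_hom; move=> a b; apply: val_inj; rewrite /= phiU.
Qed.

Lemma graph0 : graph \bot = \bot.
Proof.
by have [_ _ phi0 _] := phi_hom; apply: val_inj; rewrite /= phi0.
Qed.

Lemma graph1 : graph \top = \top.
Proof.
by have [_ _ _ phi1] := phi_hom; apply: val_inj; rewrite /= phi1.
Qed.

Fact subgraph_circI (p q : L) :
  subgraph_circ (p `&` q) = subgraph_circ p `|` subgraph_circ q.
Proof. by rewrite -graphU -circI. Qed.

Fact subgraph_circ1 : subgraph_circ \top = \bot.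
Proof. by rewrite -graph0 -circ1. Qed.

HB.instance Definition _ := isMSAlgebra.Build dM L
  subgraph_le_circ2 subgraph_circI subgraph_circ1.

Fact fiber1_subproof (y : D) : subgraph_pred (\top, y).
Proof. by have [_ _ _ phi1] := phi_hom; rewrite /subgraph_pred /= phi1. Qed.

Definition fiber1 (y : D) : L := @Subgraph phi_hom _ (fiber1_subproof y).

Lemma subgraph_circ_eq0 (p : L) : circ p = \bot <-> (val p).1 = \top.
Proof.
(* Applying ° to the first coordinates of p° = 0 gives x = x°° = 0° = 1. *)
split=> [/(congr1 (fun q : L => circ (val q).1))|p1]; last first.
  by rewrite -graph0 -circ1 -p1.
by rewrite /= -circK circ0.
Qed.

Fact subgraph_denseE (p : L) : circ p = \bot <-> fiber1 \bot <= p.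
Proof.
rewrite subgraph_circ_eq0; split=> [p1|/andP[/= p1 _]].
  by apply/andP; rewrite /= p1 le0x.
by apply/eqP; rewrite -le1x.
Qed.

(** With (1, 0) as [d_L], the right-hand side is (x, phi x) meet (1, y), which is (x, y) because y
    <= phi x. *)
Fact subgraph_circ2I_joind (p : L) :
  p = circ (circ p) `&` (p `|` fiber1 \bot).
Proof.
apply: val_inj; case: p => -[x y] yx /=; rewrite -circK.
by apply: (congr2 pair); rewrite /= ?joinx1 ?meetx1 ?joinx0 ?(meet_idPr yx).
Qed.

HB.instance Definition _ := MSAlgebra_isPrincipal.Build dM L
  subgraph_denseE subgraph_circ2I_joind.

Fact graph_skeleton (a : M) : skeleton_pred (graph a).
Proof. by apply/eqP; apply: val_inj; rewrite /= -circK. Qed.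

Definition to_skeleton (a : M) : skeleton L := Skeleton (graph_skeleton a).

Lemma to_skeleton_hom : ms_hom to_skeleton.
Proof.
split; first split.
- by move=> a b; apply: val_inj; exact: graphI.
- by move=> a b; apply: val_inj; exact: graphU.
- by apply: val_inj; exact: graph0.
- by apply: val_inj; exact: graph1.
by move=> a; apply: val_inj.
Qed.

Lemma to_skeleton_bij : bijective to_skeleton.
Proof.
exists (fun p => (subgraph_val phi_hom (val p)).1) => // p; apply: val_inj.
(* A skeleton element equals its double °, the point of the graph over its first coordinate. *)
by rewrite [RHS](eqP (valP p)); apply: val_inj; rewrite /= -circK.
Qed.

Fact fiber1_dense (y : D) : dense_pred (fiber1 y).
Proof. exact/eqP/subgraph_circ_eq0. Qed.

Definition to_dense (y : D) : dense L := Dense (fiber1_dense y).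

Lemma to_dense_hom : lattice01_hom to_dense.
Proof.
split=> [x y|x y||]; do 2![apply: val_inj] => //=.
- by apply: (congr2 pair); rewrite ?meetxx.
- by apply: (congr2 pair); rewrite ?joinxx.
Qed.

Lemma to_dense_bij : bijective to_dense.
Proof.
exists (fun p => (subgraph_val phi_hom (val p)).2) => // p; do 2![apply: val_inj] => /=.
by have /eqP/subgraph_circ_eq0 /= <- := valP p; case: subgraph_val.
Qed.

(** (a, phi a) join (1, 0) is (1, phi a). This is the compatibility that [ms_con_pairs_con_map]
    requires. *)
Lemma to_dense_phi (a : M) : to_dense (phi a) = joind (val (to_skeleton a)).
Proof.
by do 2![apply: val_inj] => /=; apply: (congr2 pair); rewrite ?joinx1 ?joinx0.
Qed.

End Subgraph.

Theorem theorem4p1 (dM dD : Order.disp_t) (M : deMorganType dM)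
    (D : tbDistrLatticeType dD) (A : set (mscon M *p latcon D))
    (hA : sublattice A) :
  representable A <->
  exists phi : M -> D, lattice01_hom phi /\
    forall (theta1 : mscon M) (theta2 : latcon D),
      A (theta1, theta2) <-> (con_map phi theta1 <= theta2)%O.
Proof.
split=> [[d [L [tau1 [tau2 [[h1 b1] [h2 b2] ->]]]]]|[phi [phi_hom AE]]].
  have [g2 tau2K g2K] := b2.
  (* The only map with [tau2 (phi a) = joind (val (tau1 a))] for all [a]. *)
  exists (g2 \o (fun a => joind (val a)) \o tau1); split.
    apply: lattice01_hom_comp (proj1 h1); apply: lattice01_hom_comp.
      exact: lattice01_hom_inv tau2K g2K h2.
    exact: joind_hom.
  by move=> s t; apply: ms_con_pairs_con_map => // a; exact: g2K.
exists dM, (subgraph phi phi_hom), (to_skeleton phi phi_hom),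
  (to_dense phi phi_hom); split.
- by split; [exact: to_skeleton_hom | exact: to_skeleton_bij].
- by split; [exact: to_dense_hom | exact: to_dense_bij].
apply/predeqP => -[s t]; rewrite AE; apply: iff_sym.
apply: ms_con_pairs_con_map (to_dense_phi phi phi_hom).
- exact: to_skeleton_hom.
- exact: to_skeleton_bij.
- exact: to_dense_hom.
- exact: to_dense_bij.
Qed.
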